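(* Let $F:\mathbb{R}^n\to\mathbb{R}^n$ be a single-valued $L$-Lipschitz operator ($L>0$), let $A:\mathbb{R}^n\rightrightarrows\mathbb{R}^n$ be a set-valued maximally monotone operator, and suppose $z^*\in\mathbb{R}^n$ satisfies $0\in F(z^* )+A(z^* )$. Let $\rho\in\left[-\frac{1}{60L},0\right]$ and suppose $E=F+A$ is $\rho$-comonotone. Let $\eta>0$ satisfy $$\frac12-\Big(12-\frac{4\rho}{\eta}\Big)\eta^2L^2+\frac{2\rho}{\eta}\ge0.$$ Let $z_0=z_{\frac12}\in\mathbb{R}^n$ be arbitrary, let $z_1=J_{\eta A}[z_0-\eta F(z_0)]$, and for $t=1,2,\dots$ define $$z_{t+\frac12}=2z_t-z_{t-1}+\frac{1}{t+1}(z_0-z_t)-\frac1t(z_0-z_{t-1}),$$ $$z_{t+1}=J_{\eta A}\Big[z_t-\eta F(z_{t+\frac12})+\frac{1}{t+1}(z_0-z_t)\Big]$$ (the Accelerated Reflected Gradient algorithm). Then for every integer $T\ge1$, $$r^{tan}_{F,A}(z_T)\le\frac{\sqrt6\,H}{\eta}\cdot\frac1T,$$ where $H^2=\|z_0-z^*\|^2+4\|z_1-z_0\|^2\le\|z_0-z^*\|^2+4\eta^2\,r^{tan}_{F,A}(z_0)^2$.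
   Context: $\langle\cdot,\cdot\rangle$ and $\|\cdot\|$ are the standard inner product and $\ell_2$-norm on $\mathbb{R}^n$. A set-valued operator $A:\mathbb{R}^n\rightrightarrows\mathbb{R}^n$ maps each point to a subset of $\mathbb{R}^n$; its graph is $\{(z,u):u\in A(z)\}$. $A$ is monotone if $\langle u-u',z-z'\rangle\ge0$ for all $(z,u),(z',u')$ in its graph, and maximally monotone if moreover its graph is not properly contained in the graph of another monotone operator. $E=F+A$ means $E(z)=\{F(z)+c:c\in A(z)\}$. $E$ is $\rho$-comonotone if $\langle u-u',z-z'\rangle\ge\rho\|u-u'\|^2$ for all $(z,u),(z',u')$ in the graph of $E$. The resolvent is $J_{\eta A}=(I+\eta A)^{-1}$, which is single-valued with domain $\mathbb{R}^n$ for $A$ maximally monotone and $\eta>0$. The tangent residual is $r^{tan}_{F,A}(z)=\min_{c\in A(z)}\|F(z)+c\|$, understood as $+\infty$ if $A(z)=\emptyset$. *)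

(* Defs.v *)
From HB Require Import structures.
From mathcomp Require Import all_boot all_order all_algebra.
From mathcomp Require Import ring lra.
From mathcomp Require Import all_classical all_reals all_analysis.

Set Implicit Arguments.
Unset Strict Implicit.
Unset Printing Implicit Defensive.

Import Order.TTheory GRing.Theory Num.Theory.
Import numFieldNormedType.Exports.

Local Open Scope classical_set_scope.
Local Open Scope ring_scope.

Section Defs.
Context {R : realType} {n : nat}.
Local Notation V := 'rV[R]_n.

Implicit Types (F : V -> V) (A B : V -> set V) (u v w z : V) (eta rho : R).

Definition dot u v : R := \sum_(i < n) u 0 i * v 0 i.

(* The library norm `|u| on 'rV[R]_n is the sup norm, hence this definition. *)
Definition norm2 u : R := Num.sqrt (dot u u).

Definition lipschitz2 (L : R) F : Prop :=
  forall z z', norm2 (F z - F z') <= L * norm2 (z - z').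

Definition graph A : set (V * V) := [set p | A p.1 p.2].

Definition comonotone rho A : Prop :=
  forall z u z' u', graph A (z, u) -> graph A (z', u') ->
    rho * norm2 (u - u') ^+ 2 <= dot (u - u') (z - z').

Definition monotone_op A : Prop :=
  forall z u z' u', graph A (z, u) -> graph A (z', u') ->
    0 <= dot (u - u') (z - z').

Definition maximally_monotone A : Prop :=
  monotone_op A /\ forall B, monotone_op B -> ~ (graph A `<` graph B).

Definition op_add F A : V -> set V := fun z => [set F z + c | c in A z].

Definition op_scale eta A : V -> set V := fun z => [set eta *: c | c in A z].

Definition op_inv A : V -> set V := fun w => [set z | A z w].

(* [resolvent eta A w z] reads z = J_{eta A}[w]; see [resolvent_set1]. *)
Definition resolvent eta A : V -> set V :=
  op_inv (op_add idfun (op_scale eta A)).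

(* The infimum of the empty set is +oo; otherwise, for A maximally monotone,
   the infimum is a minimum, see [rtan_min]. *)
Definition rtan F A z : \bar R :=
  ereal_inf [set (norm2 (F z + c))%:E | c in A z].

Lemma dot_coord u (i : 'I_n) : u 0 i ^+ 2 <= dot u u.
Proof.
rewrite /dot (bigD1 i) //= -expr2 lerDl.
by apply: sumr_ge0 => j _; rewrite -expr2 sqr_ge0.
Qed.

Lemma dot_eq0 u : dot u u <= 0 -> u = 0.
Proof.
move=> u0; apply/rowP => i; rewrite mxE; apply/eqP.
by rewrite -sqrf_eq0 eq_le sqr_ge0 andbT (le_trans (dot_coord u i)).
Qed.

Lemma dotNZl (a : R) u v : dot (- (a *: u)) v = - (a * dot u v).
Proof.
by rewrite /dot mulr_sumr -sumrN; apply: eq_bigr => i _; rewrite !mxE; ring.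
Qed.

Lemma coord_norm2 u (i : 'I_n) : `|u 0 i| <= norm2 u.
Proof. by rewrite -sqrtr_sqr; apply/ler_wsqrtr/dot_coord. Qed.

Lemma continuous_dot (f g : V -> V) :
  continuous f -> continuous g -> continuous (fun u => dot (f u) (g u)).
Proof.
move=> cf cg; apply: continuous_big => [|i _ u]; first exact: add_continuous.
have cc (h : V -> V) : continuous h -> continuous (fun u => h u 0 i).
  move=> ch x; apply: (@continuous_comp _ _ _ h (fun v : V => v 0 i)).
    exact: ch.
  exact: coord_continuous.
exact: cvgM (cc _ cf u) (cc _ cg u).
Qed.

Lemma resolvent_set1 eta A w z : 0 < eta -> monotone_op A ->
  resolvent eta A w z -> resolvent eta A w = [set z].
Proof.
move=> eta0 mA Jz; have := Jz.
move=> -[_ [c Ac <-] /= wz]; apply/seteqP; split=> z' /=; last by move=> ->.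
move=> -[_ [c' Ac' <-] /= wz']; apply/eqP; rewrite -subr_eq0; apply/eqP.
apply: dot_eq0.
have e : z' - z = - (eta *: (c' - c)).
  apply/rowP => i; move/rowP: wz => /(_ i); move/rowP: wz' => /(_ i).
  by rewrite !mxE => <- h; lra.
rewrite {1}e dotNZl oppr_le0 mulr_ge0 ?(ltW eta0) //; exact: mA.
Qed.

Lemma maximally_monotone_closed A z : maximally_monotone A -> closed (A z).
Proof.
move=> [mA maxA].
have -> : A z = \bigcap_(p in graph A) [set u | 0 <= dot (u - p.2) (z - p.1)].
  apply/seteqP; split=> [u Au [z' u'] Au'|u Hu]; first exact: mA.
  apply: contrapT => nAu.
  apply: (maxA (fun z' => [set u' | A z' u' \/ (z' = z /\ u' = u)])).
    move=> z1 u1 z2 u2; rewrite /graph /=; case=> [A1|[-> ->]]; case=> [A2|[-> ->]].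
    - exact: mA.
    - have /= := Hu (z1, u1) A1; congr (0 <= _).
      by apply: eq_bigr => i _; rewrite !mxE; ring.
    - exact: (Hu (z2, u2) A2).
    - by rewrite !subrr /dot sumr_ge0 // => i _; rewrite mxE mul0r.
  split=> [p Ap|sub]; first by left.
  by apply: nAu; apply: (sub (z, u)); right.
apply: closed_bigI => p _.
apply: (@preimage_closed _ _ (fun u => dot (u - p.2) (z - p.1)) [set x | 0 <= x]).
  move=> u _.
  apply: (@continuous_dot (fun u => u - p.2) (fun=> z - p.1)).
    by move: (p.2) => a x; apply: continuousB; [exact: cvg_id|exact: cst_continuous].
  by move=> x; exact: cst_continuous.
exact: closed_ge.
Qed.

Lemma rtan_min F A z : maximally_monotone A -> A z !=set0 ->
  exists c, [/\ A z c, rtan F A z = (norm2 (F z + c))%:E &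
    forall c', A z c' -> norm2 (F z + c) <= norm2 (F z + c')].
Proof.
move=> mA [c0 Ac0].
have cf : continuous (fun c => norm2 (F z + c)).
  have ca : continuous (fun c => F z + c).
    by move=> x; apply: continuousD; [exact: cst_continuous|exact: cvg_id].
  move=> c; apply: (@continuous_comp _ _ _ (fun c => dot (F z + c) (F z + c))).
    exact: continuous_dot.
  exact: sqrt_continuous.
pose K := A z `&` [set c | norm2 (F z + c) <= norm2 (F z + c0)].
have cK : compact K.
  apply: bounded_closed_compact; last first.
    apply: closedI; first exact: maximally_monotone_closed.
    apply: (@preimage_closed _ _ (fun c => norm2 (F z + c))
      [set x | x <= norm2 (F z + c0)]).
      by move=> ? _; exact: cf.
    exact: closed_le.
  exists (norm2 (F z + c0) + norm2 (F z)); split; first exact: num_real.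
  move=> M ltM c [_ /= cle].
  have M0 : 0 <= M.
    by apply: le_trans (ltW ltM); rewrite addr_ge0 // sqrtr_ge0.
  rewrite /Num.norm /= mx_normrE; apply/bigmax_leP; split=> // -[i j] _ /=.
  rewrite ord1; have -> : c 0 j = (F z + c) 0 j - F z 0 j by rewrite mxE; ring.
  apply: le_trans (ler_normB _ _) _; apply: le_trans (ltW ltM).
  apply: lerD; last exact: coord_norm2.
  exact: le_trans (coord_norm2 _ _) cle.
have K0 : K !=set0 by exists c0; split => //=.
have [c] := EVT_min_rV K0 cK (continuous_subspaceT cf).
rewrite inE => -[Ac cle] cmin.
have {}cmin c' : A z c' -> norm2 (F z + c) <= norm2 (F z + c').
  move=> Ac'; have [c'le|/ltW c'ge] := leP (norm2 (F z + c')) (norm2 (F z + c0)).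
    by apply: cmin; rewrite inE.
  exact: le_trans c'ge.
exists c; split=> //; apply/eqP; rewrite eq_le; apply/andP; split.
  by apply: ereal_inf_lbound; exists c.
by apply: le_ereal_inf_tmp => _ [c' Ac' <-]; rewrite lee_fin cmin.
Qed.

End Defs.

(* Main.v *)
Require Import Defs.
From mathcomp Require Import all_boot all_order all_algebra.
From mathcomp Require Import ring lra.
From mathcomp Require Import all_classical all_reals all_analysis.

(** Write [u_t = eta (F z_t + c_t)], where [c_t \in A z_t] is the element
produced by the resolvent step, and [e_t = eta (F z_t - F z_{t-1/2})] for the
error made by evaluating [F] at the reflected point.  The algorithm then reads

  [z_{t+1}   = z_t - u_{t+1} + e_{t+1} + (z_0 - z_t) / (t+1)],
  [z_{t+1/2} = z_t - u_t + e_t + (z_0 - z_t) / (t+1)],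

so that [z_{t+1} - z_{t+1/2} = - (u_{t+1} - u_t - e_{t+1} + e_t)]: the iteration
is Halpern's anchored implicit step with errors, and by the Lipschitz bound the
next error is controlled by how much [u] and [e] vary.  The tangent residual at
[z_T] is at most [|u_T| / eta], and the proof bounds [|u_T|] through

  [V_t = t(t+1)/2 (|u_t|^2 + |e_t|^2) + t <u_t, z_t - z_0>].

Expanding [V_t - V_{t+1}] leaves, besides a term that comonotonicity makes
nonnegative, a quadratic form in [u_{t+1} - u_t], [e_t], [e_{t+1}].  The condition
on [eta] is what makes this form at least [5 |e_{t+1}|^2] ([reflection_error]),
which absorbs the cross term [<u_{t+1}, e_{t+1}>] up to [|u_{t+1}|^2 / 8].
Hence [V_{t+1} <= V_t + |u_{t+1}|^2 / 8] ([potential_decrease]).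

Comonotonicity between [z_t] and the solution gives the lower bound
[V_t >= t(t+1)/4 |u_t|^2 - |z_0 - z*|^2] ([potential_lower]), and [V_1] is at most
[4 |z_1 - z_0|^2] ([potential_first]).  The increments [|u_t|^2 / 8] are thus
themselves of order [1/t^2], hence summable, and an induction closes the loop
with the constant 6 ([potential_rate]).

The bound on [H] holds because [z_1] and [z_0] are the resolvents of
[z_0 - eta F z_0] and [z_0 + eta c] for any [c \in A z_0], and resolvents of
monotone operators are nonexpansive ([first_step_le_rtan]). *)

Import Order.TTheory GRing.Theory Num.Theory.

Local Open Scope ring_scope.

(** * Euclidean inner product *)

Section InnerProduct.
Context {R : realType} {n : nat}.
Local Notation V := 'rV[R]_n.
Implicit Types (u v w : V) (a : R).

Lemma dotC u v : dot u v = dot v u.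
Proof. by apply: eq_bigr => i _; rewrite mulrC. Qed.

Lemma dotDl u v w : dot (u + v) w = dot u w + dot v w.
Proof. by rewrite -big_split; apply: eq_bigr => i _; rewrite mxE mulrDl. Qed.

Lemma dotZl a u v : dot (a *: u) v = a * dot u v.
Proof. by rewrite mulr_sumr; apply: eq_bigr => i _; rewrite mxE mulrA. Qed.

Lemma dotNl u v : dot (- u) v = - dot u v.
Proof. by rewrite -scaleN1r dotZl mulN1r. Qed.

Lemma dotDr u v w : dot w (u + v) = dot w u + dot w v.
Proof. by rewrite dotC dotDl !(dotC w). Qed.

Lemma dotZr a u v : dot v (a *: u) = a * dot v u.
Proof. by rewrite dotC dotZl dotC. Qed.

Lemma dotNr u v : dot v (- u) = - dot v u.
Proof. by rewrite dotC dotNl dotC. Qed.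

Definition dotE := (dotDl, dotDr, dotNl, dotNr, dotZl, dotZr).

Lemma dot_ge0 u : 0 <= dot u u.
Proof. by apply: sumr_ge0 => i _; rewrite -expr2 sqr_ge0. Qed.

Lemma norm2_ge0 u : 0 <= norm2 u.
Proof. exact: sqrtr_ge0. Qed.

Lemma norm2_sqr u : norm2 u ^+ 2 = dot u u.
Proof. by rewrite sqr_sqrtr // dot_ge0. Qed.

Lemma norm2Z a u : 0 <= a -> norm2 (a *: u) = a * norm2 u.
Proof.
by move=> a0; rewrite /norm2 !dotE mulrA -expr2 sqrtrM ?sqr_ge0 // sqrtr_sqr ger0_norm.
Qed.

Lemma lipschitz2_sqr (L : R) (F : V -> V) v w : lipschitz2 L F ->
  dot (F v - F w) (F v - F w) <= L ^+ 2 * dot (v - w) (v - w).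
Proof.
move=> lipF; rewrite -!norm2_sqr -exprMn.
by rewrite lerXn2r ?nnegrE ?norm2_ge0 // (le_trans (norm2_ge0 _) (lipF v w)).
Qed.

End InnerProduct.

(** * Resolvents and comonotone operators *)

Section Operators.
Context {R : realType} {n : nat}.
Local Notation V := 'rV[R]_n.
Implicit Types (F : V -> V) (A : V -> set V) (v w c : V) (eta rho : R).

Lemma resolvent_graph A eta w v : eta != 0 ->
  resolvent eta A w v -> A v (eta^-1 *: (w - v)).
Proof.
move=> eta0 [_ [c Ac <-] /= <-].
by rewrite addrC addKr scalerK.
Qed.

(** Comonotonicity scales with exponent -1: the operator [eta (F + A)] is
[rho / eta]-comonotone. *)
Lemma comonotone_scaled F A rho eta v c v' c' : 0 < eta ->
    comonotone rho (op_add F A) -> A v c -> A v' c' ->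
  let u := eta *: (F v + c) - eta *: (F v' + c') in
  rho / eta * dot u u <= dot u (v - v').
Proof.
move=> eta0 com Ac Ac' /=; rewrite -scalerBr !dotZl dotZr.
have := com v (F v + c) v' (F v' + c') (ex_intro2 _ _ c Ac erefl)
  (ex_intro2 _ _ c' Ac' erefl).
rewrite norm2_sqr => h; set d := dot _ _ in h *.
have -> : rho / eta * (eta * (eta * d)) = eta * (rho * d).
  by field; rewrite gt_eqF.
by rewrite ler_pM2l.
Qed.

(** As [v] is the resolvent of [v + eta c], this is nonexpansiveness of the
resolvent; monotonicity makes the cross term nonnegative when the square of
[(v1 - v) + eta (c1 - c)] is expanded. *)
Lemma resolvent_displacement A eta w v c v1 : 0 < eta -> monotone_op A ->
    A v c -> resolvent eta A w v1 ->
  norm2 (v1 - v) <= norm2 (w - (v + eta *: c)).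
Proof.
move=> eta0 mA Ac [_ [c1 Ac1 <-] /= <-].
apply: ler_wsqrtr.
have -> : v1 + eta *: c1 - (v + eta *: c) = (v1 - v) + eta *: (c1 - c).
  by apply/rowP => i; rewrite !mxE; ring.
rewrite [leRHS]dotDl ![dot _ (_ + eta *: _)]dotDr !dotZl !dotZr.
rewrite (dotC (v1 - v) (c1 - c)).
have := mulr_ge0 (ltW eta0) (mA _ _ _ _ Ac1 Ac : 0 <= dot (c1 - c) (v1 - v)).
have := mulr_ge0 (ltW eta0) (mulr_ge0 (ltW eta0) (dot_ge0 (c1 - c))).
lra.
Qed.

Lemma rtan_empty F A v : A v = set0 -> rtan F A v = +oo%E.
Proof. by move=> Av0; rewrite /rtan Av0 image_set0 ereal_inf0. Qed.

(** Stated for squares so that it also covers an empty [A v], where the right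
hand side is [+oo]. *)
Lemma first_step_le_rtan F A eta v v1 : 0 < eta -> maximally_monotone A ->
    resolvent eta A (v - eta *: F v) v1 ->
  ((norm2 (v1 - v) ^+ 2)%:E <= (eta ^+ 2)%:E * rtan F A v ^+ 2)%E.
Proof.
move=> eta0 mA Jv1; have [Av0|Av] := pselect (A v = set0).
  rewrite rtan_empty // expe2 mulyy gt0_muley ?leey //.
  by rewrite lte_fin exprn_gt0.
have /(rtan_min F mA)[c [Ac -> _]] : (A v !=set0)%classic by apply/set0P/eqP.
rewrite -EFin_expe -EFinM lee_fin -exprMn.
rewrite lerXn2r ?nnegrE ?norm2_ge0 // ?mulr_ge0 ?norm2_ge0 ?(ltW eta0) //.
apply: le_trans (resolvent_displacement _ _ _ _ _ _ eta0 mA.1 Ac Jv1) _.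
rewrite -norm2Z ?(ltW eta0) // /norm2.
have -> : v - eta *: F v - (v + eta *: c) = - (eta *: (F v + c)).
  by apply/rowP => i; rewrite !mxE; ring.
by rewrite dotNl dotNr opprK.
Qed.

End Operators.

(** * The potential function *)

Section Potential.
Context {R : realType} {n : nat}.
Local Notation V := 'rV[R]_n.
Implicit Types (u e v d : V) (k q r : R).

Definition potential k v0 v u e : R :=
  k * (k + 1) / 2 * (dot u u + dot e e) + k * dot u (v - v0).

(** Here [d], [e], [e'] stand for [u_{t+1} - u_t], [e_t], [e_{t+1}].  With
[p = d - e'] the right hand side is
[|p|^2 / 2 + r |p + e'|^2 + |e|^2 / 2 - |e'|^2].  Two uses of
[|x + y|^2 <= 2 |x|^2 + 2 |y|^2], one to bound the term with the negative factor
[r] and one to recover [|p + e|^2], give at least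
[(1/4 + r) |p + e|^2 - (1 - 2 r) |e'|^2].  The step size condition says that
[1/4 + r >= (6 - 2 r) q], and [q |p + e|^2 >= |e'|^2]. *)
Lemma reflection_error q r d e e' :
    0 <= q -> r <= 0 -> 0 <= 1 / 2 - (12 - 4 * r) * q + 2 * r ->
    dot e' e' <= q * dot (d - e' + e) (d - e' + e) ->
  5 * dot e' e' <=
    (1 / 2 + r) * dot d d + dot e e / 2 - dot e' e' / 2 - dot d e'.
Proof.
move=> q0 r0 cond lip.
have [p dE] : exists p, d = p + e' by exists (d - e'); rewrite subrK.
rewrite {}dE addrK in lip *.
have par x y : dot (x + y) (x + y) <= 2 * dot x x + 2 * dot y y.
  by have := dot_ge0 (x - y); rewrite !dotE (dotC y x); lra.
have h1 : 0 <= - r * (2 * dot p p + 2 * dot e' e' - dot (p + e') (p + e')).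
  by rewrite mulr_ge0 ?oppr_ge0 ?subr_ge0 ?par.
have c0 : 0 <= (12 - 4 * r) * q by rewrite mulr_ge0 //; lra.
have h2 : 0 <= (1 / 2 + 2 * r) / 2 *
    (2 * dot p p + 2 * dot e e - dot (p + e) (p + e)).
  by rewrite mulr_ge0 ?subr_ge0 ?par //; lra.
have h3 := mulr_ge0 cond (dot_ge0 (p + e)).
have h4 : 0 <= (6 - 2 * r) * (q * dot (p + e) (p + e) - dot e' e').
  by rewrite mulr_ge0 ?subr_ge0 //; lra.
have h5 : 0 <= - r * dot e e by rewrite mulr_ge0 ?oppr_ge0 ?dot_ge0.
have -> : (1 / 2 + r) * dot (p + e') (p + e') + dot e e / 2 - dot e' e' / 2
    - dot (p + e') e' = dot p p / 2 + r * dot (p + e') (p + e') + dot e e / 2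
    - dot e' e'.
  by rewrite !dotE (dotC e' p); field.
lra.
Qed.

(** The step equation expresses the anchor direction as
[v0 - v = (k + 1) (w + u' - e')] with [w = v' - v].  After this substitution the
loss of potential is [k + 1] times
[k (<u' - u, w> + |u' - u|^2 / 2 + |e|^2 / 2 - |e'|^2 / 2 - <u' - u, e'>)
 - |e'|^2 - <u', e'>]:
comonotonicity and [reflection_error] bound it below by
[(5 k - 1) |e'|^2 - <u', e'>], and Young's inequality disposes of the last
term. *)
Lemma potential_decrease k q r v0 v v' u u' e e' : 1 <= k ->
    0 <= q -> r <= 0 -> 0 <= 1 / 2 - (12 - 4 * r) * q + 2 * r ->
    v' = v - u' + e' + (1 / (k + 1)) *: (v0 - v) ->
    r * dot (u' - u) (u' - u) <= dot (u' - u) (v' - v) ->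
    dot e' e' <= q * dot (u' - u - e' + e) (u' - u - e' + e) ->
  potential (k + 1) v0 v' u' e' <= potential k v0 v u e + dot u' u' / 8.
Proof.
move=> k1 q0 r0 cond stepE com lip.
have err := reflection_error q r (u' - u) e e' q0 r0 cond lip.
have k0 : 0 < k + 1 by lra.
pose w := v' - v.
have v0E : v - v0 = - ((k + 1) *: (w + u' - e')).
  rewrite /w stepE; apply/rowP => i; rewrite !mxE; field.
  by rewrite gt_eqF.
have v'E : v' - v0 = w - (k + 1) *: (w + u' - e').
  by rewrite -v0E /w addrA subrK.
(* Young's inequality [<u', e'> <= 4 k |e'|^2 + |u'|^2 / (16 k)]; this suffices
   since [4 k <= 5 k - 1] and [(k + 1) / (16 k) <= 1 / 8]. *)
have young : 0 <= dot (8 * k *: e' - u') (8 * k *: e' - u') := dot_ge0 _.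
rewrite /potential v'E v0E.
move: com err young; rewrite -/w !dotE (dotC u' u) (dotC e' u').
move: (dot_ge0 e') (dot_ge0 u'); clear lip v0E v'E stepE.
set ee := dot e' e'; set uu := dot u' u'; set ue := dot u' e'.
move=> ee0 uu0 com err young.
have kpos : 0 < k by lra.
have {}young : (k + 1) * ue <= (k + 1) * (5 * k - 1) * ee + uu / 8.
  rewrite -(ler_pM2l kpos).
  have y1 := mulr_ge0 (ltW k0) young.
  have y2 : 0 <= k * (k + 1) * (k - 1) * ee by rewrite !mulr_ge0 //; lra.
  have y3 : 0 <= (k - 1) * uu by rewrite mulr_ge0 //; lra.
  lra.
have kk : 0 <= (k + 1) * k by rewrite mulr_ge0 ?ltW.
have := ler_wpM2l kk com; have := ler_wpM2l kk err.
lra.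
Qed.

(** Replacing [v - v0] by [(v - vs) - (v0 - vs)], comonotonicity costs at most
[k / 4 |u|^2] because [r >= - 1/4], and Young's inequality trades the other part
for [k^2 / 4 |u|^2 + |v0 - vs|^2]. *)
Lemma potential_lower k r v0 v vs u e : 1 <= k -> - (1 / 4) <= r ->
    r * dot u u <= dot u (v - vs) ->
  k * (k + 1) / 4 * dot u u - dot (v0 - vs) (v0 - vs) <= potential k v0 v u e.
Proof.
move=> k1 r4 com.
have k0 : 0 <= k by lra.
have -> : potential k v0 v u e = k * (k + 1) / 2 * (dot u u + dot e e)
    + k * dot u (v - vs) - k * dot u (v0 - vs).
  by rewrite /potential !dotE; ring.
have h1 := ler_wpM2l k0 com.
have h2 : 0 <= k * ((r + 1 / 4) * dot u u).
  by rewrite !mulr_ge0 ?dot_ge0 //; lra.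
have h3 : 0 <= k * (k + 1) / 2 * dot e e.
  by rewrite !mulr_ge0 ?dot_ge0 //; lra.
move: (dot u (v - vs)) (v0 - vs) h1 => y x h1.
have := dot_ge0 ((k / 2) *: u - x); rewrite !dotE (dotC x u).
lra.
Qed.

(** The first step has no anchor term, so [u = e - (v1 - v0)] and the potential
collapses to [2 |e|^2 - <e, v1 - v0>], with [e] small compared to [v1 - v0]. *)
Lemma potential_first q v0 v1 u e : q <= 1 / 24 -> v1 = v0 - u + e ->
    dot e e <= q * dot (v1 - v0) (v1 - v0) ->
  potential 1 v0 v1 u e <= 4 * dot (v1 - v0) (v1 - v0).
Proof.
move=> q24 stepE lip.
have -> : u = e - (v1 - v0).
  by rewrite stepE; apply/rowP => i; rewrite !mxE; ring.
rewrite /potential; move: (v1 - v0) lip => s lip.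
have h : 0 <= (1 / 24 - q) * dot s s by rewrite mulr_ge0 ?dot_ge0 // subr_ge0.
have := dot_ge0 s; have := dot_ge0 (e + s); rewrite !dotE (dotC s e); lra.
Qed.

End Potential.

(** * Rate of convergence *)

(** Induction on the sharpened bound
[f t <= 4 S + 3/4 (D + 4 S) (2/3 - 1 / (t + 1/2))].  Once [g t] is known to be at
most [6 (D + 4 S) / t^2], adding [g t / 8] increases the bound by
[3/4 (D + 4 S) / t^2 <= 3/4 (D + 4 S) (1 / (t - 1/2) - 1 / (t + 1/2))], which
telescopes.  The limit value is [4 S + (D + 4 S) / 2], and with the lower bound on
[f] this leaves [3/2 (D + 4 S) >= t^2 / 4 * g t]: exactly the constant 6. *)
Lemma potential_rate {R : realType} (D S : R) (f g : nat -> R) :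
    0 <= D -> 0 <= S ->
    f 1%N <= 4 * S ->
    (forall t, (1 <= t)%N -> f t.+1 <= f t + g t.+1 / 8) ->
    (forall t, (1 <= t)%N -> t%:R * (t%:R + 1) / 4 * g t - D <= f t) ->
    (forall t, 0 <= g t) ->
  forall T, (1 <= T)%N -> T%:R ^+ 2 * g T <= 6 * (D + 4 * S).
Proof.
move=> D0 S0 f1 fS fge g0.
have H0 : 0 <= D + 4 * S by lra.
(* The increment [g m.+2 / 8] depends on the term being bounded; it is absorbed
   by [x / 4 * g m.+2], which exceeds it since [x >= 2]. *)
have step m (b : R) (x := m.+2%:R : R) : b <= 2 / 3 ->
    f m.+1 <= 4 * S + 3 / 4 * (D + 4 * S) * b ->
  x ^+ 2 * g m.+2 <= 6 * (D + 4 * S).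
  move=> b0 fb; have := fge m.+2 isT; have := fS m.+1 isT; rewrite -/x.
  have x2 : 2 <= x by rewrite ler_nat.
  have := g0 m.+2; have : 0 <= (D + 4 * S) * (2 / 3 - b).
    by rewrite mulr_ge0 // subr_ge0.
  nra.
have fb m : f m.+1 <= 4 * S
    + 3 / 4 * (D + 4 * S) * (2 / 3 - 1 / (m%:R + 3 / 2)).
  elim: m => [|m IH].
    rewrite (_ : 2 / 3 - _ = 0) ?mulr0 ?addr0 // add0r.
    by field.
  have m0 : 0 <= m%:R :> R := ler0n _ m.
  have /step /(_ IH) gb : 2 / 3 - 1 / (m%:R + 3 / 2) <= 2 / 3 :> R.
    by rewrite gerBl divr_ge0 //; lra.
  rewrite -(natr1 m).
  have e2 : m.+2%:R = m%:R + 2 :> R by rewrite -addn2 natrD.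
  rewrite e2 in gb.
  have -> : 2 / 3 - 1 / (m%:R + 1 + 3 / 2) = 2 / 3 - 1 / (m%:R + 3 / 2)
      + 1 / ((m%:R + 3 / 2) * (m%:R + 5 / 2)) :> R.
    by field; rewrite !gt_eqF //; lra.
  apply: le_trans (fS m.+1 isT) _; rewrite mulrDr addrA lerD //.
  rewrite mulrA mulr1 ler_pdivlMr; last by rewrite mulr_gt0 //; lra.
  by have := g0 m.+2; nra.
case=> // -[|m] _; last by apply: step (fb m); rewrite gerBl divr_ge0 // addr_ge0 //; lra.
have := fge 1%N isT; have := g0 1%N; lra.
Qed.

Theorem theorem2 (R : realType) (n : nat)
    (F : 'rV[R]_n -> 'rV[R]_n) (A : 'rV[R]_n -> set 'rV[R]_n)
    (L rho eta : R) (zstar : 'rV[R]_n)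
    (z : nat -> 'rV[R]_n)  (* z t is z_t *)
    (zh : nat -> 'rV[R]_n) (* zh t is z_{t + 1/2} *)
    (H : R)
    (L_gt0 : 0 < L)
    (lipF : lipschitz2 L F)
    (maxA : maximally_monotone A)
    (zstarP : op_add F A zstar 0)
    (rho_ge : - (1 / (60 * L)) <= rho)
    (rho_le0 : rho <= 0)
    (comE : comonotone rho (op_add F A))
    (eta_gt0 : 0 < eta)
    (eta_cond : 0 <= 1 / 2 - (12 - 4 * rho / eta) * (eta ^+ 2 * L ^+ 2)
                    + 2 * rho / eta)
    (zh0 : zh 0%N = z 0%N)
    (z1 : resolvent eta A (z 0%N - eta *: F (z 0%N)) (z 1%N))
    (zhS : forall t : nat, (1 <= t)%N ->
       zh t = 2 *: z t - z t.-1 + (1 / t.+1%:R) *: (z 0%N - z t)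
              - (1 / t%:R) *: (z 0%N - z t.-1))
    (zS : forall t : nat, (1 <= t)%N ->
       resolvent eta A
         (z t - eta *: F (zh t) + (1 / t.+1%:R) *: (z 0%N - z t)) (z t.+1))
    (H_ge0 : 0 <= H)
    (HE : H ^+ 2 = norm2 (z 0%N - zstar) ^+ 2
                   + 4 * norm2 (z 1%N - z 0%N) ^+ 2) :
  (forall T : nat, (1 <= T)%N ->
     (rtan F A (z T) <= (Num.sqrt 6 * H / eta * (1 / T%:R))%:E)%E) /\
  ((H ^+ 2)%:E <= (norm2 (z 0%N - zstar) ^+ 2)%:E
                  + (4 * eta ^+ 2)%:E * rtan F A (z 0%N) ^+ 2)%E.
Proof.
split; last first.
  rewrite HE EFinD leeD2l // !EFinM -muleA lee_pmul2l // ?lte_fin //.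
  exact: first_step_le_rtan.
have eta0 : eta != 0 by rewrite gt_eqF.
(* [w t] is the point whose resolvent is [z t.+1].  It reads off the element
   [c t] of [A (z t)], and since [zh 0 = z 0] the formula at [t = 0] also
   describes the first step. *)
pose w t := z t - eta *: F (zh t) + (1 / t.+1%:R) *: (z 0%N - z t).
pose c t := eta^-1 *: (w t.-1 - z t).
pose u t := eta *: (F (z t) + c t).
pose e t := eta *: (F (z t) - F (zh t.-1)).
have Ac t : (1 <= t)%N -> A (z t) (c t).
  case: t => // -[|t] _; apply: resolvent_graph => //; last exact: zS.
  by rewrite /w /= zh0 subrr scaler0 addr0.
have uE t : u t = eta *: F (z t) + w t.-1 - z t.
  by rewrite /u /c scalerDr scalerA divff // scale1r addrA.
have stepE t : z t.+1 = z t - u t.+1 + e t.+1 + (1 / t.+1%:R) *: (z 0%N - z t).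
  by rewrite uE /e /w; apply/rowP => i; rewrite !mxE; ring.
have zhE t : (1 <= t)%N ->
    zh t = z t - u t + e t + (1 / t.+1%:R) *: (z 0%N - z t).
  case: t => // t _; rewrite zhS //= uE /e /w /=.
  by apply/rowP => i; rewrite !mxE; ring.
pose q := eta ^+ 2 * L ^+ 2; pose r := rho / eta.
have q0 : 0 <= q by rewrite mulr_ge0 ?sqr_ge0.
have r0 : r <= 0 by rewrite mulr_le0_ge0 // invr_ge0 ltW.
have cond : 0 <= 1 / 2 - (12 - 4 * r) * q + 2 * r.
  by move: eta_cond; rewrite -!(mulrA _ rho).
have rq0 : 0 <= - r * q by rewrite mulr_ge0 // oppr_ge0.
have lip t : dot (e t.+1) (e t.+1) <= q * dot (z t.+1 - zh t) (z t.+1 - zh t).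
  rewrite /e dotZl dotZr mulrA -expr2 /q -mulrA.
  by rewrite ler_pM2l ?exprn_gt0 //; exact: lipschitz2_sqr.
pose f t := potential t%:R (z 0%N) (z t) (u t) (e t).
have rate T : (1 <= T)%N -> T%:R ^+ 2 * dot (u T) (u T) <= 6 * H ^+ 2.
  rewrite HE !norm2_sqr; apply: (@potential_rate _ _ _ f (fun t => dot (u t) (u t))) => {T}.
  - exact: dot_ge0.
  - exact: dot_ge0.
  - apply: (@potential_first _ _ q); first by lra.
      by rewrite stepE subrr scaler0 addr0.
    by have := lip 0%N; rewrite zh0.
  - move=> t t1; rewrite /f -natr1; apply: (@potential_decrease _ _ _ q r) => //.
    + by rewrite ler1n.
    + by rewrite stepE natr1.
    + exact: (comonotone_scaled F A rho eta _ _ _ _ eta_gt0 comE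
        (Ac t.+1 isT) (Ac t t1)).
    + apply: le_trans (lip t) _; apply: ler_wpM2l => //.
      have -> : z t.+1 - zh t = - (u t.+1 - u t - e t.+1 + e t).
        by rewrite zhE // {1}stepE; apply/rowP => i; rewrite !mxE; ring.
      by rewrite dotNl dotNr opprK.
  - move=> t t1; apply: (@potential_lower _ _ _ r); rewrite ?ler1n //.
      by lra.
    have [cs Acs Fcs] := zstarP.
    have := comonotone_scaled F A rho eta _ _ _ _ eta_gt0 comE (Ac t t1) Acs.
    by rewrite /= Fcs scaler0 subr0.
  - by move=> t; exact: dot_ge0.
move=> T T1; have T0 : 0 < T%:R :> R by rewrite ltr0n.
apply: (@le_trans _ _ (norm2 (F (z T) + c T))%:E).
  by apply: ereal_inf_lbound; exists (c T) => //; exact: Ac.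
rewrite lee_fin mulrA mulr1 !ler_pdivlMr //.
rewrite -[leLHS]mulrA -(ler_pXn2r (isT : (0 < 2)%N)); last 2 first.
- by rewrite nnegrE !mulr_ge0 ?norm2_ge0 ?ltW.
- by rewrite nnegrE mulr_ge0 ?sqrtr_ge0.
rewrite [leRHS]exprMn [Num.sqrt 6 ^+ 2]sqr_sqrtr //.
apply: le_trans (rate T T1).
by rewrite /u dotZl dotZr !exprMn norm2_sqr le_eqVlt; apply/orP; left; apply/eqP; ring.
Qed.
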